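(* Let $G$ be a graph with an automorphism $\phi: V(G)\to V(G)$ that is an involution, and let $F_\phi(G)$ be the set of vertices fixed by $\phi$. Choose a partition $A_0\cup A_1$ of $V(G)\setminus F_\phi(G)$ such that for each $u\in V(G)\setminus F_\phi(G)$, either $u\in A_0$ and $\phi(u)\in A_1$, or $u\in A_1$ and $\phi(u)\in A_0$. Let $D=\{\{u,v\} : u\in A_0,\ v\in A_1\}$. If $F_\phi(G)\neq\emptyset$ and $V(G)\setminus F_\phi(G)\neq\emptyset$, then the graph $G'=(V(G),E(G)\setminus D)$ is a square.
   Context: All graphs are finite and simple. A partially labeled graph is a graph $H$ together with an injective map $\theta: L\to V(H)$, $L\subseteq\mathbb{N}$, whose image $\theta(L)$ is nonempty and a proper subset of $V(H)$; vertices in $\theta(L)$ are labeled. The square $HH$ is obtained from two disjoint copies of $H$ by identifying each labeled vertex $\theta(\ell)$ of the first copy with $\theta(\ell)$ of the second copy (keeping all edges, merging double edges). A graph $G$ is a square if $G$ is isomorphic to $HH$ for some partially labeled graph $H$. *)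

(* Defs.v *)
From HB Require Import structures.
From mathcomp Require Import all_boot finmap.

Set Implicit Arguments.
Unset Strict Implicit.
Unset Printing Implicit Defensive.

Local Open Scope quotient_scope.

Record sgraph := SGraph {
  vertices :> finType;
  adj : rel vertices;
  adj_sym : symmetric adj;
  adj_irrefl : irreflexive adj }.

Definition is_iso (G H : sgraph) (f : G -> H) : Prop :=
  bijective f /\ {mono f : x y / adj x y}.

Definition isomorphic (G H : sgraph) : Prop := exists f : G -> H, is_iso f.

Definition automorphism (G : sgraph) (f : G -> G) : Prop := is_iso f.

Definition fixed (G : sgraph) (f : G -> G) : {set G} := [set x | f x == x].

Section DeleteEdges.
Variables (G : sgraph) (D : {set {set G}}).

Definition del_adj : rel G := [rel x y | adj x y && ([set x; y] \notin D)].

Lemma del_adj_sym : symmetric del_adj.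
Proof. by move=> x y; rewrite /del_adj /= adj_sym setUC. Qed.

Lemma del_adj_irrefl : irreflexive del_adj.
Proof. by move=> x; rewrite /del_adj /= adj_irrefl. Qed.

Definition del_edges : sgraph := SGraph del_adj_sym del_adj_irrefl.

End DeleteEdges.

(* The set L of labels is necessarily finite, since theta is an injection of L
   into a finite vertex set. *)
Record plgraph := PLGraph {
  plg :> sgraph;
  labels : {fset nat};
  theta : labels -> plg;
  theta_inj : injective theta;
  theta_neq0 : [set theta l | l : labels] != set0;
  theta_proper : [set theta l | l : labels] \proper [set: plg] }.

Definition labeled (H : plgraph) : {set H} := [set theta l | l : labels H].

Section Square.
Variable H : plgraph.

Definition copies := (H + H)%type.

Definition copies_adj : rel copies := fun x y =>
  match x, y with
  | inl u, inl v | inr u, inr v => adj u v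
  | _, _ => false
  end.

Definition ident : rel copies := fun x y =>
  match x, y with
  | inl u, inl v | inr u, inr v => u == v
  | inl u, inr v | inr u, inl v => (u == v) && (u \in labeled H)
  end.

Lemma ident_refl : reflexive ident.
Proof. by case=> u /=. Qed.

Lemma ident_sym : symmetric ident.
Proof. by case=> u [] v /=; rewrite eq_sym //; case: eqP => // ->. Qed.

Lemma ident_trans : transitive ident.
Proof.
case=> v [] u [] w /=; do 2! [case/andP=> /eqP <- ? | move/eqP=> <-];
by rewrite eqxx.
Qed.

Canonical ident_equiv := EquivRel ident ident_refl ident_sym ident_trans.

Definition square_vertex := {eq_quot ident}.

HB.instance Definition _ := [Finite of square_vertex by <:%/].

Definition square_adj : rel square_vertex := fun X Y =>
  [exists x : copies, exists y : copies,
    [&& X == \pi_square_vertex x, Y == \pi_square_vertex y & copies_adj x y]].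

Lemma copies_adj_sym : symmetric copies_adj.
Proof. by case=> u [] v //=; rewrite adj_sym. Qed.

Lemma square_adj_sym : symmetric square_adj.
Proof.
have sub X Y : square_adj X Y -> square_adj Y X.
  case/existsP=> x /existsP[y /and3P[hx hy hxy]].
  by apply/existsP; exists y; apply/existsP; exists x; rewrite hx hy copies_adj_sym.
by move=> X Y; apply/idP/idP; apply: sub.
Qed.

Lemma square_adj_irrefl : irreflexive square_adj.
Proof.
move=> X; apply/negbTE/negP => /existsP[x /existsP[y /and3P[/eqP-> /eqP/eqmodP]]].
by case: x y => u [] v //= /eqP->; rewrite adj_irrefl.
Qed.

Definition square : sgraph := SGraph square_adj_sym square_adj_irrefl.

End Square.

Definition is_square (G : sgraph) : Prop :=
  exists H : plgraph, isomorphic G (square H).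

(* Main.v *)
Require Import Defs.
From mathcomp Require Import all_boot.
From mathcomp Require Import finmap.

(** Take [H] to be the subgraph of [G] induced on the complement of [A1], with
    exactly the fixed vertices labeled.  The inclusion and [phi] embed two
    copies of [H] in [G]; their images, the complements of [A1] and [A0], cover
    [G] and meet in the labeled vertices.  Deleting the edges between [A0] and
    [A1] leaves precisely the edges lying inside one of the two images. *)

Set Implicit Arguments.
Unset Strict Implicit.
Unset Printing Implicit Defensive.

Local Open Scope quotient_scope.

Section Induced.
Variables (G : sgraph) (S : {set G}).

Definition induced_adj : rel {x : G | x \in S} :=
  fun x y => adj (val x) (val y).

Lemma induced_adj_sym : symmetric induced_adj.
Proof. by move=> x y; apply: adj_sym. Qed.

Lemma induced_adj_irrefl : irreflexive induced_adj.
Proof. by move=> x; apply: adj_irrefl. Qed.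

Definition induced : sgraph := SGraph induced_adj_sym induced_adj_irrefl.

End Induced.

Section LabelSet.
Variables (H : sgraph) (S : {set H}).

(** Labels must be natural numbers, so the elements of [S] are numbered from 0 to [#|S| - 1] in the
    order of [enum]; any nonempty proper [S] thus becomes a labeled set. *)
Definition set_labels : {fset nat} := [fset n in iota 0 #|S|]%fset.

Lemma set_labels_lt (l : set_labels) : val l < #|S|.
Proof. by have := valP l; rewrite !inE mem_iota. Qed.

Definition set_theta (l : set_labels) : H :=
  enum_val (Ordinal (set_labels_lt l)).

Lemma set_theta_inj : injective set_theta.
Proof. by move=> l m /enum_val_inj [] /val_inj. Qed.

Lemma imset_set_theta : [set set_theta l | l : set_labels] = S.
Proof.
apply/setP=> x; apply/imsetP/idP => [[l _ ->]|Sx]; first exact: enum_valP.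
pose i := enum_rank_in Sx x.
have iL : val i \in set_labels by rewrite !inE mem_iota /= ltn_ord.
exists [` iL]%fset => //.
rewrite -[LHS](enum_rankK_in Sx Sx); congr enum_val; exact: val_inj.
Qed.

Hypotheses (S_neq0 : S != set0) (S_proper : S \proper [set: H]).

Lemma set_theta_neq0 : [set set_theta l | l : set_labels] != set0.
Proof. by rewrite imset_set_theta. Qed.

Lemma set_theta_proper : [set set_theta l | l : set_labels] \proper [set: H].
Proof. by rewrite imset_set_theta. Qed.

Definition label_set : plgraph :=
  PLGraph set_theta_inj set_theta_neq0 set_theta_proper.

Lemma labeled_label_set : labeled label_set = S.
Proof. exact: imset_set_theta. Qed.

End LabelSet.

Lemma isomorphic_sym (G H : sgraph) : isomorphic G H -> isomorphic H G.
Proof.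
case=> f [[g fK gK] f_adj]; exists g; split; first by exists f.
by move=> x y; rewrite -f_adj !gK.
Qed.

(** Reduces the quotient to a map on the disjoint union: since the kernel of [h] is exactly [ident],
    [h] descends to an injective map on the square; the other two hypotheses make it onto and match
    the edges. *)
Lemma isomorphic_square (G : sgraph) (H : plgraph) (h : copies H -> G) :
    (forall c d, (h c == h d) = ident c d) ->
    (forall x, exists c, h c = x) ->
    (forall x y, reflect (exists c d, [/\ h c = x, h d = y & copies_adj c d])
                         (adj x y)) ->
  isomorphic G (square H).
Proof.
move=> h_eq h_surj h_adj; apply: isomorphic_sym.
pose g (X : square H) : G := h (repr (X : square_vertex H)).
(* The value of [g] does not depend on the representative that [repr] picks. *)
have gE c : g (\pi_(square_vertex H) c) = h c.
  by apply/eqP; rewrite h_eq; apply/eqmodP; rewrite reprK.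
have g_inj : injective g.
  move=> X Y /eqP; rewrite h_eq => XY.
  by rewrite -[X](@reprK _ (square_vertex H)) -[Y](@reprK _ (square_vertex H));
     apply/eqmodP.
have g_surj x : x \in codom g.
  by have [c <-] := h_surj x; rewrite -gE; apply: codom_f.
exists g; split.
  have gK : cancel (fun x => iinv (g_surj x)) g by move=> x; apply: f_iinv.
  by exists (fun x => iinv (g_surj x)) => //; apply: inj_can_sym.
move=> X Y; apply/h_adj/existsP => [[c [d [cX dY cd]]]|[c]].
  exists c; apply/existsP; exists d; rewrite cd andbT.
  by apply/andP; split; apply/eqP/g_inj; rewrite gE.
by case/existsP=> d /and3P[/eqP-> /eqP-> cd]; exists c, d; rewrite !gE.
Qed.

(** An unordered pair does not record which end comes from [A], hence the two disjuncts. *)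
Lemma mem_set2_imset2 (T : finType) (A B : {set T}) (x y : T) :
  ([set x; y] \in [set [set u; v] | u in A, v in B])
    = (x \in A) && (y \in B) || (y \in A) && (x \in B).
Proof.
apply/imset2P/idP => [[u v Au Bv xyE]|/orP[]/andP[Ax By]].
- have [xuv yuv] : x \in [set u; v] /\ y \in [set u; v].
    by rewrite -xyE set21 set22.
  have [uxy vxy] : u \in [set x; y] /\ v \in [set x; y].
    by rewrite xyE set21 set22.
  move: xuv yuv uxy vxy; rewrite !inE.
  by do 4![case/orP=> /eqP ?]; subst; rewrite ?Au ?Bv ?orbT.
- by exists x y.
by exists y x; rewrite // setUC.
Qed.

Theorem theorem3p2 (G : sgraph) (phi : G -> G)
    (phi_aut : automorphism phi) (phi_invol : involutive phi)
    (A0 A1 : {set G})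
    (A_cover : A0 :|: A1 = ~: fixed phi) (A_disj : [disjoint A0 & A1])
    (A_swap : forall u : G, u \in ~: fixed phi ->
       (u \in A0 /\ phi u \in A1) \/ (u \in A1 /\ phi u \in A0))
    (fix_neq0 : fixed phi <> set0) (nfix_neq0 : ~: fixed phi <> set0) :
  is_square (del_edges [set [set u; v] | u in A0, v in A1]).
Proof.
have [_ phi_adj] := phi_aut.
have nfixE x : (phi x != x) = (x \in A0) || (x \in A1).
  by rewrite -in_setU A_cover !inE.
have A01 x : x \in A0 -> x \notin A1 by move=> /(disjointFr A_disj)->.
have phiA0 x : x \in A0 -> phi x \in A1.
  move=> A0x; have nfx : x \in ~: fixed phi by rewrite -A_cover inE A0x.
  by case: (A_swap _ nfx) => -[] // A1x; move: (A01 _ A0x); rewrite A1x.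
have phiA1 x : x \in A1 -> phi x \in A0.
  move=> A1x; have nfx : x \in ~: fixed phi by rewrite -A_cover inE A1x orbT.
  by case: (A_swap _ nfx) => -[] // A0x; move: (A01 _ A0x); rewrite A1x.
(* So [phi] carries the vertex set of [H] onto the complement of [A0]. *)
have phi_nA1 x : (phi x \notin A1) = (x \notin A0).
  by congr (~~ _); apply/idP/idP => [/phiA1|/phiA0]; rewrite ?phi_invol.
pose H := induced (~: A1).
have nA1 (u : H) : val u \notin A1 by have := valP u; rewrite inE.
have inH x : x \notin A1 -> x \in ~: A1 by rewrite inE.
pose toH x (A1x : x \notin A1) : H := Sub x (inH x A1x).
pose S : {set H} := [set u | phi (val u) == val u].
have S_neq0 : S != set0.
  have /eqP/set0Pn[x] := fix_neq0; rewrite inE => fx.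
  have A1x : x \notin A1.
    by apply/negP=> A1x; move: (nfixE x); rewrite fx A1x orbT.
  by apply/set0Pn; exists (toH x A1x); rewrite inE.
have S_proper : S \proper [set: H].
  have [x A0x] : exists x, x \in A0.
    have /eqP/set0Pn[x] := nfix_neq0; rewrite -A_cover inE.
    by case/orP=> [|/phiA1]; [exists x | exists (phi x)].
  rewrite properT; apply/eqP=> /setP/(_ (toH x (A01 x A0x))).
  by rewrite !inE /= => fx; move: (nfixE x); rewrite fx A0x.
exists (label_set S_neq0 S_proper).
pose h (c : copies (label_set S_neq0 S_proper)) : G :=
  match c with inl u => val (u : H) | inr u => phi (val (u : H)) end.
(* The two images meet only in fixed vertices: if [val u = phi (val v)], then [phi (val v)] avoids
   [A1], so [val v] avoids [A0]; it also avoids [A1], hence is fixed. *)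
have glue (u v : H) : (val u == phi (val v)) = (u == v) && (u \in S).
  rewrite inE; apply/eqP/andP => [uv|[/eqP<- /eqP->]//].
  have fv : phi (val v) = val v.
    apply/eqP; rewrite -[_ == _]negbK nfixE (negPf (nA1 v)) orbF -phi_nA1 -uv.
    exact: nA1.
  by rewrite -val_eqE /= uv !fv.
pose G' := del_edges [set [set u; v] | u in A0, v in A1].
have adjE (x y : G) : @adj G' x y =
    adj x y && ~~ ((x \in A0) && (y \in A1) || (y \in A0) && (x \in A1)).
  by rewrite -mem_set2_imset2.
apply: (@isomorphic_square G' _ h) => [|x|x y].
- case=> u [] v; rewrite /= ?labeled_label_set.
  + by rewrite val_eqE.
  + exact: glue.
  + by rewrite eq_sym glue eq_sym; case: eqP => // ->.
  by rewrite (inj_eq (inv_inj phi_invol)) val_eqE.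
- case: (boolP (x \in A1)) => [/phiA1/A01|] A1x.
    by exists (inr (toH _ A1x)); rewrite /= phi_invol.
  by exists (inl (toH _ A1x)).
apply: (iffP idP) => [|[c [d [<- <-]]]].
  rewrite adjE negb_or !negb_and => /andP[xy xyD].
  (* Otherwise one end lies in [A1] and one in [A0]: if distinct ends, the edge was deleted; if the
     same end, disjointness fails. *)
  have : (x \notin A1) && (y \notin A1) || (x \notin A0) && (y \notin A0).
    move/implyP: (A01 x) (A01 y) xyD => + /implyP.
    by do 4!case: (_ \in _).
  rewrite -(phi_nA1 x) -(phi_nA1 y) => /orP[]/andP[Ax Ay].
    by exists (inl (toH _ Ax)), (inl (toH _ Ay)).
  (* An edge avoiding [A0] is pulled back along [phi] to the second copy. *)
  exists (inr (toH _ Ax)), (inr (toH _ Ay)).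
  by split; rewrite /= ?phi_invol // /induced_adj /= phi_adj.
rewrite adjE.
case: c d => u [] v //= uv.
  by rewrite (negPf (nA1 u)) (negPf (nA1 v)) !andbF andbT.
(* The second image avoids [A0], so none of its edges is deleted. *)
have nA0 (w : H) : phi (val w) \notin A0 by rewrite -phi_nA1 phi_invol nA1.
by rewrite phi_adj (negPf (nA0 u)) (negPf (nA0 v)) andbT.
Qed.
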